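(* Every line set of $\mathrm{PG}(N,q)$ in higgledy-piggledy arrangement contains at least $N + \left\lfloor \frac{N}{2}\right\rfloor - \left\lfloor\frac{N-1}{q}\right\rfloor$ lines.
   Context: $\mathrm{PG}(N,q)$ is the $N$-dimensional projective space over $\mathbb{F}_q$. A cutting blocking set of $\mathrm{PG}(N,q)$ is a point set $S$ such that for every hyperplane $H$, $S\cap H$ spans $H$. A set of lines of $\mathrm{PG}(N,q)$ is in higgledy-piggledy arrangement if the union of their point sets is a cutting blocking set. *)

(* Defs.v *)
From HB Require Import structures.
From mathcomp Require Import all_boot all_order all_algebra.

Set Implicit Arguments.
Unset Strict Implicit.
Unset Printing Implicit Defensive.

Import GRing.Theory VectorInternalTheory.
Local Open Scope ring_scope.

(* Over a finite field, a subspace is determined by its canonical matrix, so   *)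
(* there are finitely many of them and {set {vspace _}} is available.          *)
(* The subType instance of {vspace _} lives in VectorInternalTheory.           *)
HB.instance Definition _ (F : finFieldType) (vT : vectType F) :=
  [Countable of {vspace vT} by <:].
HB.instance Definition _ (F : finFieldType) (vT : vectType F) :=
  [Finite of {vspace vT} by <:].

Section ProjectiveSpace.

Variables (F : finFieldType) (N : nat).

(* PG(N, q), with q = #|F|, is the lattice of linear subspaces of F^(N+1); a   *)
(* subspace of projective dimension k is one of linear dimension k + 1, and    *)
(* the zero subspace is the empty projective subspace.                         *)
Definition pg_subspace := {vspace 'rV[F]_N.+1}.

Definition pg_points : {set pg_subspace} := [set U | \dim U == 1].

Definition pg_lines : {set pg_subspace} := [set U | \dim U == 2].

Definition pg_hyperplanes : {set pg_subspace} := [set U | \dim U == N].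

Definition points_of (U : pg_subspace) : {set pg_subspace} :=
  [set p in pg_points | (p <= U)%VS].

Definition pg_span (S : {set pg_subspace}) : pg_subspace :=
  (\sum_(p in S) p)%VS.

Definition cutting_blocking_set (S : {set pg_subspace}) : Prop :=
  S \subset pg_points /\
  forall H : pg_subspace, H \in pg_hyperplanes ->
    pg_span (S :&: points_of H) = H.

Definition higgledy_piggledy (L : {set pg_subspace}) : Prop :=
  L \subset pg_lines /\
  cutting_blocking_set (\bigcup_(l in L) points_of l).

End ProjectiveSpace.

(* Main.v *)
(* Let t = (N - 1) / q and suppose that L has fewer than N + N / 2 - t lines. *)
(* Some hyperplane ker f contains N / 2 lines of L (or all of them), so a set R *)
(* of at most N - 1 - t lines remains. Every l in R meets ker f in one point; *)
(* the functionals vanishing at these points form a space of dimension at least *)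
(* t + 2, on whose dual R gives a set of at most N - 1 - t <= (t + 1)(q - 1) *)
(* points of the affine space f = 1 of dimension t + 1. By Jamison's theorem *)
(* they do not meet all affine hyperplanes. One that is missed gives a *)
(* hyperplane H of PG(N, q), other than ker f, in which every point on a line *)
(* of L lies in ker f, so these points do not span H. *)
Require Import Defs.
From mathcomp Require Import all_boot all_order all_algebra.
From mathcomp Require Import zify.

Set Implicit Arguments.
Unset Strict Implicit.
Unset Printing Implicit Defensive.

Import GRing.Theory.
Local Open Scope ring_scope.

(** * Power sums over a finite field and Jamison's bound *)

Section AffineCovering.

Variable F : finFieldType.

Lemma exists_expf_neq1 (e : nat) :
  (0 < e)%N -> (e < #|F|.-1)%N -> exists2 a : F, a != 0 & a ^+ e != 1.
Proof.
move=> e_gt0 lt_e; apply/exists_inP; apply: contraT.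
rewrite negb_exists => /forallP allroots.
have p_neq0 : ('X^e - 1 : {poly F}) != 0 by rewrite monic_neq0 ?monicXnsubC.
have := max_poly_roots p_neq0 (rs := enum (predC1 (0 : F))).
rewrite size_XnsubC // -cardE cardC1 enum_uniq ltnS leqNgt lt_e => absurd.
suff: false by []; apply: absurd => //.
apply/allP=> x; rewrite mem_enum => x_neq0.
by move: (allroots x); rewrite /root !hornerE subr_eq0 [x != 0]x_neq0 negbK.
Qed.

(** For [e > 0], replacing [x] by [a * x] multiplies the sum by [a ^+ e], and some nonzero [a] makes
    this factor differ from 1. *)
Lemma sum_expf_eq0 (e : nat) : (e < #|F|.-1)%N -> \sum_(x : F) x ^+ e = 0.
Proof.
case: (posnP e) => [-> _ | e_gt0 lt_e].
  under eq_bigr do rewrite expr0.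
  (* Translation by 1 permutes [F], so the sum of 1 over [F] vanishes. *)
  have : \sum_(x : F) x = \sum_(x : F) (x + 1).
    exact: reindex_inj (addIr 1).
  by rewrite big_split /= -[LHS]addr0 => /addrI <-.
have [a a_neq0 ae_neq1] := exists_expf_neq1 e_gt0 lt_e.
have : \sum_(x : F) x ^+ e = \sum_(x : F) (a * x) ^+ e.
  exact: reindex_inj (mulfI a_neq0).
under [X in _ = X]eq_bigr do rewrite exprMn.
rewrite -mulr_sumr => /eqP.
rewrite -subr_eq0 -{1}[\sum_x _]mul1r -mulrBl mulf_eq0 subr_eq0 eq_sym.
by rewrite (negPf ae_neq1) => /eqP.
Qed.

Variable d : nat.

(** The sum factors into one-variable power sums, and by averaging some exponent is below q - 1. *)
Lemma sum_monomial_eq0 (e : 'I_d -> nat) :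
  (\sum_j e j < d * #|F|.-1)%N ->
  \sum_(x : {ffun 'I_d -> F}) \prod_j x j ^+ e j = 0.
Proof.
move=> lt_e; rewrite -(bigA_distr_bigA (fun j y => y ^+ e j)).
have [j lt_ej] : exists j, (e j < #|F|.-1)%N.
  apply/existsP; apply: contraTT lt_e.
  rewrite negb_exists => /forallP ge_e; rewrite -leqNgt -{1}[d]card_ord.
  by rewrite -sum_nat_const leq_sum // => j _; rewrite leqNgt.
by rewrite (bigD1 j) //= sum_expf_eq0 ?mul0r.
Qed.

(** The polynomial has degree below d(q - 1). The monomial factor lets the induction on [s] absorb
    each new variable into an exponent. *)
Lemma sum_prod_affine_eq0 (I : Type) (s : seq I) (a : I -> 'I_d -> F)
    (c : I -> F) (e : 'I_d -> nat) :
  (\sum_j e j + size s < d * #|F|.-1)%N ->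
  \sum_(x : {ffun 'I_d -> F})
    (\prod_j x j ^+ e j) * \prod_(i <- s) (\sum_j a i j * x j + c i) = 0.
Proof.
elim: s e => [|i s IHs] e /= lt_e.
  under eq_bigr do rewrite big_nil mulr1.
  by apply: sum_monomial_eq0; rewrite addn0 in lt_e.
pose mono e (x : {ffun 'I_d -> F}) := \prod_j x j ^+ e j.
pose P (x : {ffun 'I_d -> F}) := \prod_(i <- s) (\sum_j a i j * x j + c i).
pose e' k j := (e j + (j == k))%N.
have sum_e' k : (\sum_j e' k j = (\sum_j e j).+1)%N.
  rewrite big_split /= [X in (_ + X)%N](bigD1 k) //= eqxx.
  by rewrite [X in (_ + (_ + X))%N]big1 ?addn0 ?addn1 // => j /negPf ->.
have monoE k x : mono e x * x k = mono (e' k) x.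
  rewrite /mono (bigD1 k) //= [RHS](bigD1 k) //= /e' eqxx exprD mulrAC.
  by congr (_ * _); apply: eq_bigr => j /negPf ->; rewrite addn0.
under eq_bigr => x _.
  rewrite big_cons -/(mono e x) -/(P x) mulrA mulrDr mulrDl mulr_sumr mulr_suml.
  rewrite (eq_bigr (fun k => a i k * (mono (e' k) x * P x))); last first.
    by move=> k _; rewrite -monoE mulrCA !mulrA.
  rewrite [_ * c i]mulrC -mulrA.
  over.
rewrite big_split /= exchange_big /= -mulr_sumr IHs ?mulr0 ?addr0; last first.
  by apply: leq_trans lt_e; rewrite addnS.
apply: big1 => k _; rewrite -mulr_sumr IHs ?mulr0 //.
by rewrite sum_e' addSnnS.
Qed.

(* The product of the a_i . x - 1 is nonzero at x = 0 but sums to 0 over F^d. *)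
Lemma affine_hyperplanes_not_cover (I : eqType) (s : seq I)
    (a : I -> 'I_d -> F) :
  (size s < d * #|F|.-1)%N ->
  exists2 x : {ffun 'I_d -> F}, x != 0
    & forall i, i \in s -> \sum_j a i j * x j != 1.
Proof.
move=> lt_s.
have [/exists_inP[x x_neq0 /allP ne1]|] :=
  boolP [exists (x : {ffun 'I_d -> F} | x != 0),
           all (fun i => \sum_j a i j * x j != 1) s].
  by exists x.
rewrite negb_exists => /forallP no_x; case/negP: (oner_neq0 F).
have := @sum_prod_affine_eq0 _ s a (fun=> -1) (fun=> 0%N).
rewrite big1 // add0n => /(_ lt_s).
under eq_bigr do rewrite big1 ?mul1r //.
rewrite (bigD1 (0 : {ffun 'I_d -> F})) //= [X in _ + X]big1 => [|x x_neq0].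
  rewrite addr0 => /eqP; rewrite prodf_seq_eq0 => /hasP[i _ /=].
  by rewrite big1 ?sub0r ?oppr_eq0 // => j _; rewrite ffunE mulr0.
apply/eqP; rewrite prodf_seq_eq0.
move: (no_x x); rewrite x_neq0 -has_predC.
by apply: sub_has => i /=; rewrite negbK subr_eq0.
Qed.

End AffineCovering.

(** * Linear functionals, encoded as columns acting on row vectors *)

Section Functionals.

Variables (F : fieldType) (n : nat).
Implicit Types (f g : 'cV[F]_n) (v w : 'rV[F]_n) (U : {vspace 'rV[F]_n}).

Definition kerv f : {vspace 'rV[F]_n} := lker (linfun (mulmxr f)).

Lemma mem_kerv f v : (v \in kerv f) = (v *m f == 0).
Proof. by rewrite memv_ker lfunE. Qed.

Lemma exists_eval1 f v : v *m f != 0 -> exists c, (c *: v) *m f = 1.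
Proof.
rewrite [v *m f]mx11_scalar => vf_neq0; exists ((v *m f) 0 0)^-1.
rewrite -scalemxAl {2}[v *m f]mx11_scalar scale_scalar_mx mulVf //.
by apply: contraNneq vf_neq0 => ->; rewrite raddf0.
Qed.

Lemma exists_preimage1 f : f != 0 -> exists v, v *m f = 1.
Proof.
move=> f_neq0; have [i fi_neq0] : exists i, f i 0 != 0.
  apply/existsP; apply: contraNT f_neq0; rewrite negb_exists => /forallP f0.
  by apply/eqP/colP => i; rewrite mxE; apply/eqP; rewrite -[_ == _]negbK.
have [|c cE] := @exists_eval1 f (delta_mx 0 i);
  last by exists (c *: delta_mx 0 i).
rewrite -rowE; apply: contraNneq fi_neq0 => /rowP/(_ 0).
by rewrite !mxE => ->.
Qed.

Lemma dim_kerv f : f != 0 -> \dim (kerv f) = n.-1.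
Proof.
move=> /exists_preimage1[v vf1].
pose phi : 'Hom('rV[F]_n, 'rV[F]_1) := linfun (mulmxr f).
have := limg_ker_dim phi fullv.
rewrite capfv dimvf dim_matrix mul1r -/(kerv f).
suff -> : \dim (limg phi) = 1%N by rewrite addn1 => /(congr1 predn).
apply/eqP; rewrite eqn_leq; apply/andP; split.
  by rewrite (leq_trans (dimvS (subvf _))) // dimvf dim_matrix.
rewrite lt0n dimv_eq0; apply: contraTneq (memv_img phi (memvf v)) => ->.
by rewrite lfunE memv0 /= vf1 oner_eq0.
Qed.

(** The columns of [G] are functionals vanishing on [U]; the second clause is their linear
    independence. *)
Lemma annihilator_basis U :
  exists G : 'M[F]_(n, n - \dim U),
    (forall v, v \in U -> v *m G = 0)
    /\ (forall x : 'cV_(n - \dim U), G *m x = 0 -> x = 0).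
Proof.
pose M := \matrix_(i < \dim U) (vbasis U)`_i.
pose K := kermx M^T.
have rankK : (n - \dim U <= \rank K)%N.
  by rewrite mxrank_ker leq_sub2l // rank_leq_col.
pose G0 := row_base K.
(* [rankK] is only a lower bound, so [S] selects the first [n - \dim U] rows of the basis. *)
pose S : 'M[F]_(n - \dim U, \rank K) := pid_mx (n - \dim U).
have S_free : row_free S by rewrite /row_free rank_pid_mx ?eqxx.
exists (S *m G0)^T; split=> [v Uv | x Gx0].
  have -> : v = (\row_i coord (vbasis U) i v) *m M.
    rewrite {1}(coord_vbasis Uv) mulmx_sum_row.
    by apply: eq_bigr => i _; rewrite rowK mxE.
  rewrite -mulmxA -[M *m _]trmxK trmx_mul trmxK -mulmxA.
  have /sub_kermxP -> : (G0 <= K)%MS by rewrite eq_row_base.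
  by rewrite !(mulmx0, trmx0).
apply: trmx_inj; rewrite trmx0.
apply: (row_free_inj S_free); apply: (row_free_inj (row_base_free K)).
by rewrite !mul0mx -mulmxA; apply: trmx_inj; rewrite trmx_mul trmxK trmx0.
Qed.

End Functionals.

(** * Hyperplanes and their intersections with the lines *)

Section Projective.

Variables (F : finFieldType) (N : nat).
Implicit Types (L R : {set pg_subspace F N}) (l H : pg_subspace F N).

(** A functional [g] vanishing at [v1] cannot be 1 there, so the line giving [v1] imposes no
    condition and [s] is one shorter than [R]. If [R] is empty, any [v1] with value 1 serves. *)
Lemma exists_transversal_points (f : 'cV[F]_N.+1) R :
  f != 0 -> (forall l, l \in R -> ~~ (l <= kerv f)%VS) ->
  exists (v : pg_subspace F N -> 'rV[F]_N.+1) (v1 : 'rV[F]_N.+1)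
         (s : seq (pg_subspace F N)),
    [/\ forall l, l \in R -> v l \in l /\ v l *m f = 1, v1 *m f = 1,
        size s = #|R|.-1 & forall l, l \in R -> l \in s \/ v1 = v l].
Proof.
move=> f_neq0 R_f.
have /fin_all_exists[v vP] l :
    exists u : 'rV[F]_N.+1, l \in R -> u \in l /\ u *m f = 1.
  have [Rl | _] := boolP (l \in R); last by exists 0.
  have /subvPn[u lu] := R_f l Rl; rewrite mem_kerv => /exists_eval1[c cuf].
  by exists (c *: u); split; rewrite ?memvZ.
have [v0 v0f] := exists_preimage1 f_neq0.
case: (enum R) (mem_enum R) (cardE R) => [|l1 s] Rs card_R.
  exists v, v0, [::]; split=> //; first by rewrite card_R.
  by move=> l; rewrite -Rs.
exists v, (v l1), s; split=> //; last first.
- by move=> l; rewrite -Rs inE => /orP[/eqP -> |]; [right | left].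
- by rewrite card_R.
- by have [|] := vP l1; rewrite // -Rs mem_head.
Qed.

(* Normalising each line by a point v l of the affine space f = 1, the kernel  *)
(* of g - f avoids v l exactly when the affine hyperplane g = 1 does. Taking   *)
(* g v1 = 0 for one of these points puts the origin of the affine space at v1. *)
Lemma exists_bad_hyperplane (f : 'cV[F]_N.+1) R :
  f != 0 -> (forall l, l \in R -> \dim l = 2%N /\ ~~ (l <= kerv f)%VS) ->
  (#|R|.-1 < (N - #|R|) * #|F|.-1)%N ->
  exists2 H, H \in pg_hyperplanes F N &
    ~~ (H <= kerv f)%VS /\ forall l, l \in R -> (l :&: H <= kerv f)%VS.
Proof.
move=> f_neq0 RP ltR.
have [|v [v1 [s [vP v1f size_s sP]]]] :=
  exists_transversal_points f_neq0 (R := R).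
  by move=> l /RP[].
(* Functionals vanishing on [W] form a space of dimension at least [N - #|R|]; on it, each condition
   to avoid, value 1 at [v l], is an affine hyperplane missing 0. *)
pose W := (<[v1]> + \sum_(l in R) (l :&: kerv f))%VS.
have dimW : (\dim W <= #|R|.+1)%N.
  rewrite (leq_trans (dimv_add_leqif _ _)) // -[#|R|.+1]add1n leq_add //.
    by rewrite dim_vline leq_b1.
  rewrite (leq_trans (dimv_leq_sum _ _ _)) // -sum1_card leq_sum // => l Rl.
  have [dim_l l_f] := RP l Rl; rewrite -ltnS -dim_l.
  rewrite ltn_neqAle dimvS ?capvSl // andbT; apply: contra l_f => /eqP dim_cap.
  by apply/capv_idPl/eqP; rewrite eqEdim capvSl dim_cap leqnn.
have [G [GW G_inj]] := annihilator_basis W.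
have [|x x_neq0 xP] :=
  affine_hyperplanes_not_cover (s := s) (fun l j => (v l *m G) 0 j).
  rewrite size_s (leq_trans ltR) // leq_mul2r orbC -subSS leq_sub2l //.
pose g := G *m \col_j x j.
have gW u : u \in W -> u *m g = 0 by move=> Wu; rewrite mulmxA GW ?mul0mx.
have g_neq0 : g != 0.
  apply: contraNneq x_neq0 => /G_inj/colP x0.
  by apply/eqP/ffunP => j; have := x0 j; rewrite !mxE ffunE.
have gv1 : v1 *m g = 0 by rewrite gW // memvE addvSl.
have gv l : l \in R -> v l *m g != 1.
  move=> Rl; have [s_l | <-] := sP l Rl; last by rewrite gv1 eq_sym oner_eq0.
  apply: contra (xP l s_l) => /eqP/matrixP/(_ 0 0).
  rewrite mulmxA mxE [RHS]mxE eqxx mulr1n => vg1.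
  apply/eqP; rewrite -[RHS]vg1.
  by apply: eq_bigr => j _; rewrite [X in _ = _ * X]mxE.
exists (kerv (g - f)).
  rewrite inE dim_kerv //; apply/eqP => /subr0_eq gf.
  by move: gv1; rewrite gf v1f => /eqP; rewrite oner_eq0.
split=> [|l Rl].
  (* Adding a multiple of [v1] to [w] keeps [g] equal to 1 and brings [f] to 1, giving a vector of
     [H] outside [kerv f]. *)
  have [w wg] := exists_preimage1 g_neq0.
  pose c := 1 - (w *m f) 0 0.
  have wf : w *m f = (1 - c)%:M by rewrite /c subKr -mx11_scalar.
  have cvf : (c *: v1) *m f = c%:M by rewrite -scalemxAl v1f scalemx1.
  apply/subvPn; exists (w + c *: v1); rewrite mem_kerv.
    rewrite mulmxBr !mulmxDl cvf wf wg -scalemxAl gv1 scaler0 addr0 -raddfD.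
    by rewrite subrK subrr.
  by rewrite mulmxDl cvf wf -raddfD subrK oner_eq0.
apply/subvP => u; rewrite memv_cap !mem_kerv => /andP[lu].
have [lvl vlf] := vP l Rl.
pose c := (u *m f) 0 0; have uf : u *m f = c%:M by rewrite -mx11_scalar.
(* This difference lies in [l] and [kerv f], hence in [W]. So [g] takes the value [c] times that at
   [v l], while [f] takes [c]; equality on [H] forces [c = 0]. *)
have : (u - c *: v l) *m g = 0.
  apply: gW; apply: subvP (addvSr _ _) _ _.
  apply: subvP (sumv_sup l Rl (subvv _)) _ _.
  rewrite memv_cap memvB ?memvZ //= mem_kerv mulmxBl -scalemxAl vlf uf.
  by rewrite scalemx1 subrr.
rewrite mulmxBl mulmxBr -scalemxAl => /subr0_eq ->; rewrite uf -scalemx1.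
by rewrite -scalerBr !scaler_eq0 subr_eq0 (negPf (gv l Rl)) oner_eq0.
Qed.

(** Any [N %/ 2] lines span a subspace of linear dimension at most [N], so a nonzero functional
    kills them all. *)
Lemma exists_hyperplane_containing L :
  L \subset pg_lines F N ->
  exists2 f : 'cV[F]_N.+1, f != 0
    & (#|[set l in L | ~~ (l <= kerv f)%VS]| <= #|L| - N %/ 2)%N.
Proof.
move=> /subsetP Llines.
pose S := [set l in take (N %/ 2) (enum L)].
have S_L : S \subset L.
  by apply/subsetP => l; rewrite inE => /mem_take; rewrite mem_enum.
have card_S : #|S| = minn (N %/ 2) #|L|.
  rewrite cardsE (card_uniqP _) ?take_uniq ?enum_uniq //.
  by rewrite size_take -cardE /minn.
pose U := (\sum_(l in S) l)%VS.
have dimU : (\dim U <= N)%N.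
  rewrite (leq_trans (dimv_leq_sum _ _ _)) //.
  rewrite (eq_bigr (fun=> 2%N)) => [|l /(subsetP S_L)/Llines]; last first.
    by rewrite inE => /eqP.
  by rewrite sum_nat_const card_S; lia.
have [G [GU G_inj]] := annihilator_basis U.
have d_gt0 : (0 < N.+1 - \dim U)%N by rewrite subn_gt0 ltnS.
pose j := Ordinal d_gt0.
exists (col j G).
  apply/eqP; rewrite colE => /G_inj/colP/(_ j).
  by rewrite !mxE !eqxx => /eqP; rewrite oner_eq0.
have -> : (#|L| - N %/ 2 = #|L :\: S|)%N.
  by rewrite cardsD (setIidPr S_L) card_S; lia.
apply/subset_leq_card/subsetP => l; rewrite !inE => /andP[-> l_f].
rewrite andbT; apply: contra l_f => Sl.
apply/subvP => u lu; rewrite mem_kerv colE mulmxA GU ?mul0mx //.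
by apply: subvP lu; apply: sumv_sup (subvv _); rewrite inE.
Qed.

End Projective.

(** * Counting and conclusion *)

Lemma card_bound (N q m r : nat) : (0 < N)%N -> (1 < q)%N ->
  (m < N + N %/ 2 - (N - 1) %/ q)%N -> (r <= m - N %/ 2)%N ->
  (r.-1 < (N - r) * q.-1)%N.
Proof.
move=> N_gt0 q_gt1 ltm ler.
have := divn_eq (N - 1) q; have := ltn_pmod (N - 1) (ltnW q_gt1).
move: ltm; set t := ((N - 1) %/ q)%N; set b := ((N - 1) %% q)%N => ltm ltb Nq.
(* Since [r <= N - 1 - t] and [N - 1 = t * q + b] with [b < q], also [r <= (t + 1) * (q - 1)].
   Passing to [r.-1] makes this strict, and [1 < q] settles [r = 0]. *)
have le_t : (t.+1 <= N - r)%N by nia.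
apply: (@leq_trans (t.+1 * q.-1)); last by rewrite leq_mul2r le_t orbT.
nia.
Qed.

Local Close Scope ring_scope.

Theorem theorem3p12 (F : finFieldType) (N : nat) (hN : 0 < N)
    (L : {set pg_subspace F N}) (hL : higgledy_piggledy L) :
  N + N %/ 2 - (N - 1) %/ #|F| <= #|L|.
Proof.
have [Llines [_ Lspan]] := hL; rewrite leqNgt; apply/negP => ltL.
have [f f_neq0] := exists_hyperplane_containing Llines.
set R := [set _ in _ | _] => leR.
have [l||H hypH [H_f RH]] := @exists_bad_hyperplane F N f R f_neq0.
- by rewrite inE => /andP[/(subsetP Llines)]; rewrite inE => /eqP.
- exact: card_bound hN (card_finNzRing_gt1 F) ltL leR.
(* [H] is spanned by its points on lines of [L], so placing each of them in [kerv f] gives the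
   contradiction. *)
case/negP: H_f; rewrite -(Lspan H hypH); apply/subv_sumP => p.
rewrite in_setI => /andP[/bigcupP[l Ll]].
rewrite !inE => /andP[_ p_l] /andP[_ p_H].
have [l_f | l_f] := boolP (l <= kerv f)%VS; first exact: subv_trans l_f.
by apply: subv_trans (RH l _); rewrite ?subv_cap ?p_l // inE Ll.
Qed.
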